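(* Let $N_m=3^m+1$ for $m\ge1$. (1) The subset $Y$ of the $3$-adic Cantor set $\Sigma_{3,\bar2}$ given by $$Y:=\Big\{\lambda=\sum_{j=0}^\infty a_j3^j:\ \text{all } a_{2k}\in\{0,1\},\ \text{all } a_{2k+1}=0\Big\}\subset\mathbb{Z}_3$$ is a $3$-adic path set fractal having $\dim_H(Y)=\frac12\log_3 2\approx0.315464$. This set satisfies $Y\subset\mathcal{C}(1,N_{2k+1})$ for all $k\ge0$, and in consequence $$Y\subseteq\bigcap_{k=1}^\infty\mathcal{C}(1,N_{2k+1}).$$ (2) One has $$\dim_H\Big(\{\lambda\in\Sigma_{3,\bar2}:N_{2k+1}\lambda\in\Sigma_{3,\bar2}\ \text{for all } k\ge0\}\Big)\ge\dim_H(Y)=\tfrac12\log_3 2.$$ Therefore $\dim_H(\mathcal{E}_\star(\mathbb{Z}_3))\ge\frac12\log_3 2\approx 0.315464$.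
   Context: $\mathbb{Z}_3$ denotes the $3$-adic integers with the $3$-adic metric ($|3|_3=1/3$), and $\dim_H$ is Hausdorff dimension with respect to it. $\Sigma_{3,\bar2}\subset\mathbb{Z}_3$ is the set of all $\sum_{j\ge0}a_j3^j$ with every $a_j\in\{0,1\}$. For an integer $M\ge1$, $\mathcal{C}(1,M)=\{\lambda\in\Sigma_{3,\bar2}:M\lambda\in\Sigma_{3,\bar2}\}$. The $3$-adic generalized exceptional set $\mathcal{E}_\star(\mathbb{Z}_3)$ is the set of $\lambda\in\mathbb{Z}_3$ such that there are infinitely many integers $M\ge1$ with $M\not\equiv0\pmod3$, including $M=1$, for which $M\lambda\in\Sigma_{3,\bar2}$. A $3$-adic path set fractal is a set $K\subset\mathbb{Z}_3$ for which there is a finite directed graph with edges labeled by symbols in $\{0,1,2\}$ (loops and multiple edges allowed) and a marked vertex $v$ such that $K$ is the set of all $\sum_{j\ge0}a_j3^j$ where $(a_0,a_1,\ldots)$ ranges over the sequences of successive labels of infinite directed walks starting at $v$. *)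

(* Defs.v *)
From HB Require Import structures.
From mathcomp Require Import all_boot all_order all_algebra.
From mathcomp Require Import all_classical all_reals all_analysis.

Set Implicit Arguments.
Unset Strict Implicit.
Unset Printing Implicit Defensive.

Import Order.TTheory GRing.Theory Num.Theory.

Local Open Scope classical_set_scope.
Local Open Scope ring_scope.

(* The inverse limit of the rings Z/3^n: [res x n] is the representative in
   [0, 3^n) of the class of x modulo 3^n. *)
Record Z3 := MkZ3 {
  res : nat -> nat;
  resP : forall n, (res n.+1 %% 3 ^ n)%N = res n }.

HB.instance Definition _ := gen_eqMixin Z3.
HB.instance Definition _ := gen_choiceMixin Z3.

Lemma Z3_ext (x y : Z3) : (forall n, res x n = res y n) -> x = y.
Proof.
case: x y => [x Hx] [y Hy] /= /funext xy; subst y.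
by congr MkZ3; exact: Prop_irrelevance.
Qed.

Lemma res_lt (x : Z3) n : (res x n < 3 ^ n)%N.
Proof. by rewrite -resP ltn_mod expn_gt0. Qed.

Lemma res_small (x : Z3) n : (res x n %% 3 ^ n)%N = res x n.
Proof. by rewrite modn_small ?res_lt. Qed.

Lemma modn_exp3S a n : ((a %% 3 ^ n.+1) %% 3 ^ n = a %% 3 ^ n)%N.
Proof. by rewrite modn_dvdm // dvdn_exp2l. Qed.

Definition Z3_of_nat (k : nat) : Z3 :=
  @MkZ3 (fun n => k %% 3 ^ n)%N (fun n => modn_exp3S k n).

Fact Z3_add_subproof (x y : Z3) n :
  (((res x n.+1 + res y n.+1) %% 3 ^ n.+1) %% 3 ^ n
   = (res x n + res y n) %% 3 ^ n)%N.
Proof. by rewrite modn_exp3S -modnDm !resP. Qed.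
Definition Z3_add x y := @MkZ3 (fun n => (res x n + res y n) %% 3 ^ n)%N
  (Z3_add_subproof x y).

Fact Z3_mul_subproof (x y : Z3) n :
  (((res x n.+1 * res y n.+1) %% 3 ^ n.+1) %% 3 ^ n
   = (res x n * res y n) %% 3 ^ n)%N.
Proof. by rewrite modn_exp3S -modnMm !resP. Qed.
Definition Z3_mul x y := @MkZ3 (fun n => (res x n * res y n) %% 3 ^ n)%N
  (Z3_mul_subproof x y).

Fact Z3_opp_subproof (x : Z3) n :
  (((3 ^ n.+1 - res x n.+1) %% 3 ^ n.+1) %% 3 ^ n
   = (3 ^ n - res x n) %% 3 ^ n)%N.
Proof.
rewrite modn_exp3S; apply/eqP.
rewrite -(eqn_modDr (res x n.+1)) subnK; last exact/ltnW/res_lt.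
rewrite -[in X in _ == X]modnDmr resP subnK; last exact/ltnW/res_lt.
by rewrite expnS modnMl modnn.
Qed.
Definition Z3_opp x := @MkZ3 (fun n => (3 ^ n - res x n) %% 3 ^ n)%N
  (Z3_opp_subproof x).

Fact Z3_addA : associative Z3_add.
Proof. by move=> x y z; apply: Z3_ext => n /=; rewrite modnDml modnDmr addnA. Qed.
Fact Z3_addC : commutative Z3_add.
Proof. by move=> x y; apply: Z3_ext => n /=; rewrite addnC. Qed.
Fact Z3_add0 : left_id (Z3_of_nat 0) Z3_add.
Proof. by move=> x; apply: Z3_ext => n /=; rewrite mod0n add0n res_small. Qed.
Fact Z3_addN : left_inverse (Z3_of_nat 0) Z3_opp Z3_add.
Proof.
move=> x; apply: Z3_ext => n /=.
by rewrite modnDml subnK ?modnn ?mod0n //; exact/ltnW/res_lt.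
Qed.
HB.instance Definition _ :=
  GRing.isZmodule.Build Z3 Z3_addA Z3_addC Z3_add0 Z3_addN.

Fact Z3_mulA : associative Z3_mul.
Proof. by move=> x y z; apply: Z3_ext => n /=; rewrite modnMml modnMmr mulnA. Qed.
Fact Z3_mulC : commutative Z3_mul.
Proof. by move=> x y; apply: Z3_ext => n /=; rewrite mulnC. Qed.
Fact Z3_mul1 : left_id (Z3_of_nat 1) Z3_mul.
Proof. by move=> x; apply: Z3_ext => n /=; rewrite modnMml mul1n res_small. Qed.
Fact Z3_mulD : left_distributive Z3_mul +%R.
Proof.
move=> x y z; apply: Z3_ext => n.
by rewrite /= modnMml modnDm mulnDl.
Qed.
Fact Z3_1neq0 : Z3_of_nat 1 != 0.
Proof. by apply/eqP => /(congr1 (fun x => res x 1)). Qed.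
HB.instance Definition _ := GRing.Zmodule_isComNzRing.Build Z3
  Z3_mulA Z3_mulC Z3_mul1 Z3_mulD Z3_1neq0.

HB.instance Definition _ := isPointed.Build Z3 0.

Lemma res0 n : res 0 n = 0%N. Proof. exact: mod0n. Qed.
Lemma resD (x y : Z3) n : res (x + y) n = ((res x n + res y n) %% 3 ^ n)%N.
Proof. by []. Qed.
Lemma resM (x y : Z3) n : res (x * y) n = ((res x n * res y n) %% 3 ^ n)%N.
Proof. by []. Qed.
Lemma res_nat (k n : nat) : res (k%:R : Z3) n = (k %% 3 ^ n)%N.
Proof.
elim: k => [|k IH]; first by rewrite mod0n res0.
by rewrite -addn1 natrD resD IH /= modnDm.
Qed.

Lemma res_trunc (x : Z3) n m : (n <= m)%N -> (res x m %% 3 ^ n)%N = res x n.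
Proof.
move=> /subnK <-; elim: (m - n)%N => [|k IH]; first by rewrite add0n res_small.
by rewrite addSn -[RHS]IH -(resP x (k + n)) modn_dvdm // dvdn_exp2l // leq_addl.
Qed.

Lemma subZ3_eq0 (x y : Z3) n : res (x - y) n = 0%N <-> res x n = res y n.
Proof.
split=> [xy0|xy]; last first.
  by rewrite resD xy -(resD y (- y)) subrr res0.
by rewrite -[in LHS](subrK y x) resD xy0 add0n res_small.
Qed.

Lemma Z3_neq0 (x : Z3) : x != 0 -> exists n, (res x n.+1 != 0)%N.
Proof.
move=> /eqP x0; apply: contra_notP x0 => /forallNP x0.
apply: Z3_ext => -[|n]; first by have := res_lt x 0; rewrite ltnS leqn0 => /eqP.
by rewrite res0; apply/eqP/negPn/negP/x0.
Qed.

(* The largest v such that 3^v divides x, if x != 0. *)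
Definition val3 (x : Z3) : nat :=
  if pselect (exists n, (res x n.+1 != 0)%N) is left ex then ex_minn ex else 0.

Definition abs3 (R : realType) (x : Z3) : R :=
  if x == 0 then 0 else 3^-1 ^+ val3 x.

Lemma abs3_le (R : realType) (x : Z3) n :
  abs3 R x <= 3^-1 ^+ n <-> res x n = 0%N.
Proof.
have i30 : 0 < (3^-1 : R) by rewrite invr_gt0 ltr0n.
have i31 : (3^-1 : R) < 1 by rewrite invf_lt1 ?ltr1n ?ltr0n.
rewrite /abs3; case: eqVneq => [->|x0].
  by split=> _; [exact: res0 | rewrite exprn_ge0 ?ltW].
rewrite /val3; case: pselect => [ex|/(_ (Z3_neq0 x0))//].
case: ex_minnP => v xv vmin; rewrite ler_iXn2l //.
split=> [nv|xn].
  have [n0|n0] := posnP n; last apply/eqP.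
    by have := res_lt x 0; rewrite n0 ltnS leqn0 => /eqP.
  apply: contraT => xn; have := vmin n.-1; rewrite prednK // => /(_ xn).
  by move=> /(leq_trans nv); rewrite leqNgt ltn_predL n0.
rewrite leqNgt; apply: contra xv => vn.
by rewrite -(res_trunc x vn) xn mod0n.
Qed.

Lemma abs3_ge0 (R : realType) (x : Z3) : 0 <= abs3 R x.
Proof. by rewrite /abs3; case: eqP => // _; rewrite exprn_ge0 // invr_ge0. Qed.

Lemma abs3_eq0 (R : realType) (x : Z3) : abs3 R x = 0 -> x = 0.
Proof.
rewrite /abs3; case: eqP => // _ /eqP.
by rewrite expf_eq0 invr_eq0 pnatr_eq0 andbF.
Qed.

Lemma abs3N (R : realType) (x : Z3) : abs3 R (- x) = abs3 R x.
Proof.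
suff le y : abs3 R (- y) <= abs3 R y.
  by apply/eqP; rewrite eq_le le -[X in abs3 R X <= _]opprK le.
rewrite [leRHS]/abs3; case: eqVneq => [->|y0].
  by rewrite oppr0 /abs3 eqxx.
apply/abs3_le; rewrite -sub0r; apply/subZ3_eq0.
by rewrite res0; apply/esym/(abs3_le R); rewrite /abs3 (negbTE y0).
Qed.

Lemma abs3_ultra (R : realType) (x y : Z3) :
  abs3 R (x + y) <= Num.max (abs3 R x) (abs3 R y).
Proof.
wlog xy : x y / abs3 R x <= abs3 R y.
  move=> H; have /orP[/H //|/H] := le_total (abs3 R x) (abs3 R y).
  by rewrite addrC maxC.
rewrite (max_r xy); have [y0|y0] := eqVneq y 0.
  have x0 : x = 0.
    apply: (@abs3_eq0 R); apply/eqP; rewrite eq_le abs3_ge0 andbT.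
    by rewrite (le_trans xy) // y0 /abs3 eqxx.
  by rewrite x0 y0 addr0.
have yE : abs3 R y = 3^-1 ^+ val3 y by rewrite /abs3 (negbTE y0).
rewrite yE; apply/abs3_le; rewrite resD.
have -> : res x (val3 y) = 0%N by apply/(abs3_le R); rewrite -yE.
have -> : res y (val3 y) = 0%N by apply/(abs3_le R); rewrite -yE.
by rewrite mod0n.
Qed.

(* The uniformity of the inverse limit topology; it does not mention R, and
   for every R it is the one induced by the 3-adic metric (see dist3_ent). *)
Definition ent3 : set_system (Z3 * Z3) :=
  [set E | exists n, [set xy | res xy.1 n = res xy.2 n] `<=` E].

Fact ent3_filter : Filter ent3.
Proof.
constructor.
- by exists 0%N.
- move=> P Q [n nP] [m mQ]; exists (maxn n m) => -[x y] /= xy; split.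
  + apply: nP => /=.
    by rewrite -!(res_trunc _ (leq_maxl n m)) xy.
  + apply: mQ => /=.
    by rewrite -!(res_trunc _ (leq_maxr n m)) xy.
- by move=> P Q PQ [n nP]; exists n; exact: subset_trans nP PQ.
Qed.

Fact ent3_diagonal A : ent3 A -> diagonal `<=` A.
Proof. by move=> [n nA] xy xyE; apply: nA; rewrite /= xyE. Qed.

Fact ent3_inv A : ent3 A -> ent3 (A^-1)%relation.
Proof. by move=> [n nA]; exists n => -[x y] /= xy; apply: nA => /=. Qed.

Fact ent3_split A : ent3 A -> exists2 B, ent3 B & (B \; B `<=` A)%relation.
Proof.
move=> [n nA]; exists [set xy | res xy.1 n = res xy.2 n]; first by exists n.
by move=> [x z] [y /= xy yz]; apply: nA; rewrite /= xy.
Qed.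

HB.instance Definition _ :=
  isUniform.Build Z3 ent3_filter ent3_diagonal ent3_inv ent3_split.

Section metric.
Variable R : realType.

Definition dist3 (x y : Z3) : R := abs3 R (x - y).

Fact dist3_ge0 x y : 0 <= dist3 x y.
Proof. exact: abs3_ge0. Qed.

Fact dist3_eq0 x y : dist3 x y = 0 -> x = y.
Proof. by move=> /abs3_eq0/subr0_eq. Qed.

Let ball3 (x : Z3) (e : R) : set Z3 := [set y | dist3 x y < e].

Fact ball3_center x (e : R) : 0 < e -> ball3 x e x.
Proof. by rewrite /ball3 /= /dist3 subrr /abs3 eqxx. Qed.

Fact ball3_sym x y (e : R) : ball3 x e y -> ball3 y e x.
Proof. by rewrite /ball3 /= /dist3 -abs3N opprB. Qed.

Fact ball3_triangle x y z (e1 e2 : R) :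
  ball3 x e1 y -> ball3 y e2 z -> ball3 x (e1 + e2) z.
Proof.
rewrite /ball3 /= /dist3 => xy yz; rewrite -[x](subrK y) -addrA.
apply: (le_lt_trans (abs3_ultra R _ _)).
rewrite gt_max (lt_le_trans xy) ?(lt_le_trans yz) //.
- by rewrite lerDr; exact: le_trans (abs3_ge0 _ _) (ltW xy).
- by rewrite lerDl; exact: le_trans (abs3_ge0 _ _) (ltW yz).
Qed.

Fact dist3_ent : entourage = entourage_ ball3.
Proof.
have i30 : 0 < (3^-1 : R) by rewrite invr_gt0 ltr0n.
apply/seteqP; split=> E /=.
  move=> [n nE]; exists (3^-1 ^+ n); first by rewrite /= exprn_gt0.
  move=> -[x y] /= xy; apply: nE => /=; apply/subZ3_eq0.
  by apply/(abs3_le R)/ltW.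
move=> [e /= e0 eE].
pose n := Num.bound e^-1.
have ne : 3^-1 ^+ n < e.
  rewrite exprVn -[ltRHS]invrK ltf_pV2 ?posrE ?invr_gt0 ?exprn_gt0 //.
  apply: (lt_le_trans (upper_nthrootP (leqnn n))).
  by rewrite lerXn2r ?nnegrE ?ler_nat.
exists n => -[x y] /= /subZ3_eq0 /(abs3_le R) xy.
by apply: eE => /=; exact: le_lt_trans ne.
Qed.

HB.instance Definition _ := Uniform_isPseudoMetric.Build R Z3
  ball3_center ball3_sym ball3_triangle dist3_ent.

HB.instance Definition _ := PseudoMetric_isMetric.Build R Z3
  dist3_ge0 dist3_eq0 (fun _ _ => erefl).

End metric.

Section hausdorff_dimension.
Context {R : realType} {T : metricType R}.
Local Open Scope ereal_scope.

(* [set 0] accounts for the empty set, whose ereal_sup would be -oo. *)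
Definition diam (U : set T) : \bar R :=
  ereal_sup ([set 0] `|` [set (mdist x y)%:E | x in U & y in U]).

(* The empty set has weight 0 even for s = 0, where 0 `^ 0 = 1. *)
Definition hausdorff_weight (s : R) (U : set T) : \bar R :=
  if U == set0 then 0 else poweR (diam U) s.

Definition hausdorff_premeasure (s delta : R) (A : set T) : \bar R :=
  ereal_inf [set \sum_(0 <= i <oo) hausdorff_weight s (U i) | U in
    [set U : nat -> set T | A `<=` \bigcup_i U i /\
                            forall i, diam (U i) <= delta%:E]].

Definition hausdorff_measure (s : R) (A : set T) : \bar R :=
  ereal_sup [set hausdorff_premeasure s delta A | delta in
    [set delta : R | (0 < delta)%R]].

Definition hausdorff_dim (A : set T) : \bar R :=
  ereal_inf [set s%:E | s in
    [set s : R | (0 <= s)%R /\ hausdorff_measure s A = 0]].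

End hausdorff_dimension.

Notation digits := (nat -> 'I_3).

Definition sum3 (a : digits) : Z3 :=
  limn (series (fun j => (a j : nat)%:R * 3%:R ^+ j : Z3)).

Fact sum3_res_subproof (a : digits) n :
  ((\sum_(0 <= j < n.+1) a j * 3 ^ j) %% 3 ^ n
   = \sum_(0 <= j < n) a j * 3 ^ j)%N.
Proof.
have lt m : (\sum_(0 <= j < m) a j * 3 ^ j < 3 ^ m)%N.
  elim: m => [|m IH]; first by rewrite big_nil.
  rewrite big_nat_recr //= expnS mulSn -addSn leq_add //.
  by rewrite leq_mul2r -ltnS ltn_ord orbT.
by rewrite big_nat_recr //= addnC modnMDl modn_small.
Qed.

Lemma res_sum3_partial (a : digits) N :
  series (fun j => (a j : nat)%:R * 3%:R ^+ j : Z3) N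
  = (\sum_(0 <= j < N) a j * 3 ^ j)%N%:R.
Proof.
by rewrite /series /= natr_sum; apply: eq_bigr => j _; rewrite natrM natrX.
Qed.

Lemma sum3_cvg (a : digits) :
  series (fun j => (a j : nat)%:R * 3%:R ^+ j : Z3) @ \oo --> sum3 a.
Proof.
pose l := MkZ3 (sum3_res_subproof a).
apply/cvg_ex; exists l => A; rewrite -nbhs_entourageE => -[E [n nE] EA].
exists n => // N /= nN; apply: EA; rewrite /xsection /= inE; apply: nE => /=.
rewrite res_sum3_partial res_nat; exact/esym/(res_trunc l nN).
Qed.

Definition Sigma3 : set Z3 :=
  [set sum3 a | a in [set a : digits | forall j, (a j : nat) \in [:: 0; 1]%N]].

Definition C1 (M : nat) : set Z3 :=
  [set x | Sigma3 x /\ Sigma3 (M%:R * x)].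

Definition exceptional_multipliers (x : Z3) : set nat :=
  [set M | [/\ (1 <= M)%N, ~~ (3 %| M)%N & Sigma3 (M%:R * x)]].

Definition E_star : set Z3 :=
  [set x | infinite_set (exceptional_multipliers x) /\
           exceptional_multipliers x 1%N].

(* Edges form a type of their own, so loops and multiple edges are allowed. *)
Definition path_set_fractal (K : set Z3) : Prop :=
  exists (V E : finType) (src tgt : E -> V) (lab : E -> 'I_3) (v : V),
    K = [set sum3 (lab \o w) | w in [set w : nat -> E |
           src (w 0%N) = v /\ forall j, tgt (w j) = src (w j.+1)]].

Definition Nm (m : nat) : nat := (3 ^ m + 1)%N.

Definition Y : set Z3 :=
  [set sum3 a | a in [set a : digits | forall k,
     (a k.*2 : nat) \in [:: 0; 1]%N /\ (a k.*2.+1 : nat) = 0%N]].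

(* Main.v *)
(* Lower bound for the dimension of Y: sending t in [0, 1[ to the 3-adic number
   whose digits in even positions are the binary digits of t is a map g into Y
   with |s - t| <= |g s - g t|_3 ^ ((1/2) log_3 2), so a cover of Y with small
   Hausdorff sum would pull back to a cover of [0, 1[ of small Lebesgue measure.
   Upper bound: Y has 2^n residues modulo 9^n.
   If x is in Y and m is odd, then x and 3^m x have their nonzero digits in
   positions of opposite parity, so (3^m + 1) x is computed without carries. *)
Require Import Defs.
From mathcomp Require Import all_boot all_order all_algebra.
From mathcomp Require Import all_classical all_reals all_analysis.
From mathcomp Require Import zify ring lra.

Import Order.TTheory GRing.Theory Num.Theory.
Import numFieldNormedType.Exports.
Local Open Scope classical_set_scope.
Local Open Scope ring_scope.

(** * Residues, sums and shifts of 3-adic digit expansions *)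

Lemma sum3_lt (a : digits) n : (\sum_(0 <= j < n) a j * 3 ^ j < 3 ^ n)%N.
Proof.
elim: n => [|n IH]; first by rewrite big_nil.
rewrite big_nat_recr //= expnS mulSn -addSn leq_add //.
by rewrite leq_mul2r -ltnS ltn_ord orbT.
Qed.

Lemma dvdn_sum_exp3 (F : nat -> nat) n N :
  (3 ^ n %| \sum_(n <= j < N) F j * 3 ^ j)%N.
Proof.
rewrite big_nat_cond; apply: (big_ind (dvdn (3 ^ n))) => //.
  by move=> *; exact: dvdn_add.
by move=> j /andP[/andP[nj _] _]; rewrite dvdn_mull // dvdn_exp2l.
Qed.

(** [sum3] is a topological limit, but the residue modulo [3 ^ n] is locally constant. It is
    therefore that of a late partial sum, whose terms from index [n] on are divisible by [3 ^ n]. *)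
Lemma res_sum3 (a : digits) n :
  res (sum3 a) n = (\sum_(0 <= j < n) a j * 3 ^ j)%N.
Proof.
have near : nbhs (sum3 a) [set y | res (sum3 a) n = res y n].
  rewrite -nbhs_entourageE.
  exists [set xy | res xy.1 n = res xy.2 n]; first by exists n.
  by move=> y; rewrite /xsection /= inE.
have [N _ /(_ (N + n)%N (leq_addr _ _))] := sum3_cvg near.
rewrite /= res_sum3_partial res_nat => ->.
rewrite (big_cat_nat (n := n)) ?leq_addl //=.
rewrite -modnDmr (eqP (dvdn_sum_exp3 _ _ _)) addn0.
by rewrite modn_small ?sum3_lt.
Qed.

(** Since [c j] is itself a digit, the hypothesis says that the addition produces no carry. *)
Lemma sum3D (a b c : digits) :
  (forall j, c j = (a j + b j)%N :> nat) -> sum3 c = sum3 a + sum3 b.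
Proof.
move=> cE; apply: Z3_ext => n; rewrite resD !res_sum3 -big_split /=.
under [in RHS]eq_bigr do rewrite -mulnDl -cE.
by rewrite modn_small ?sum3_lt.
Qed.

Definition shift_digits (m : nat) (a : digits) : digits :=
  fun j => if (m <= j)%N then a (j - m)%N else ord0.

Lemma sum3_shift (m : nat) (a : digits) :
  sum3 (shift_digits m a) = (3 ^ m)%:R * sum3 a.
Proof.
apply: Z3_ext => n; rewrite resM res_nat !res_sum3 modnMml.
have low k : (k <= m)%N ->
    (\sum_(0 <= j < k) shift_digits m a j * 3 ^ j)%N = 0%N.
  move=> km; rewrite big_nat big1 // => j /andP[_ jk].
  by rewrite /shift_digits leqNgt (leq_trans jk km).
(* If [n <= m], both sides vanish modulo [3 ^ n]. Otherwise the digits of [a] from position [n - m]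
   on contribute a multiple of [3 ^ n] once multiplied by [3 ^ m]. *)
have [nm|/ltnW mn] := leqP n m.
  by rewrite low // -(subnK nm) expnD -mulnA mulnCA modnMr.
rewrite -[LHS](modn_small (sum3_lt _ n)).
rewrite (big_cat_nat (n := m)) //= low // add0n.
rewrite [in RHS](big_cat_nat (n := (n - m)%N)) ?leq_subr //= mulnDr.
rewrite -[in RHS]modnDmr (eqP (_ : 3 ^ n %| 3 ^ m * _)%N) ?addn0; last first.
  rewrite -{1}(subnKC mn) expnD dvdn_pmul2l ?expn_gt0 //.
  exact: dvdn_sum_exp3.
congr (_ %% _)%N; rewrite -{1}[m]add0n big_addn big_distrr /=.
apply: eq_bigr => j _; rewrite /shift_digits leq_addl addnK expnD.
by rewrite mulnA mulnC.
Qed.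

(** * Multipliers and the path set presentation of [Y] *)

Lemma Y_Sigma3 : Y `<=` Sigma3.
Proof.
move=> _ [a Ya <-]; exists a => // j; rewrite -[j]odd_double_half.
case: (odd j); last by rewrite add0n; case: (Ya j./2).
by rewrite add1n; case: (Ya j./2) => _ ->.
Qed.

Lemma Y_mulNm (x : Z3) (k : nat) : Y x -> Sigma3 ((Nm k.*2.+1)%:R * x).
Proof.
move=> [a Ya <-]; set m := k.*2.+1; pose b := shift_digits m a.
(* The parity of the support and the bound 1 are packed into one inequality. As [m] is odd, the
   shifted digits satisfy the complementary one, so the digit sums are at most 1. *)
have small j : (a j <= ~~ odd j)%N.
  rewrite -[j]odd_double_half oddD odd_double addbF oddb.
  have [] := Ya j./2; case: (odd j); first by move=> _; rewrite add1n => ->.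
  by rewrite add0n !inE => /orP[]/eqP-> _.
have bsmall j : (b j <= odd j)%N.
  rewrite /b /shift_digits; case: leqP => //= mj.
  rewrite (leq_trans (small _)) // oddB // /m /= odd_double.
  by case: (odd j).
have ab j : (a j + b j <= 1)%N.
  by rewrite (leq_trans (leq_add (small j) (bsmall j))) //; case: (odd j).
have ab3 j : (a j + b j < 3)%N by exact: leq_ltn_trans (ab j) _.
exists (fun j => inord (a j + b j)).
  move=> j; rewrite inordK //.
  by rewrite !inE; case: (_ + _)%N (ab j) => [|[]].
rewrite (@sum3D a b) => [|j]; last by rewrite inordK.
by rewrite sum3_shift /Nm natrD mulrDl mul1r addrC.
Qed.

Lemma Y_C1 (k : nat) : Y `<=` C1 (Nm k.*2.+1).
Proof. by move=> x Yx; split; [exact: Y_Sigma3 | exact: Y_mulNm]. Qed.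

(** The multipliers [Nm k.*2.+1] are pairwise distinct and congruent to 1 modulo 3. *)
Lemma Y_E_star : Y `<=` E_star.
Proof.
move=> x Yx; split; last by split=> //; rewrite mul1r; exact: Y_Sigma3.
apply: (@sub_infinite_set _ (range (fun k => Nm k.*2.+1))).
  move=> _ [k _ <-]; split; [by rewrite /Nm addn1| |exact: Y_mulNm].
  by rewrite /Nm expnS dvdn_addr ?dvdn_mulr.
rewrite (eq_finite_set (inj_card_eq _)); first exact: infinite_nat.
move=> i j _ _ /addIn/eqP; rewrite eqn_exp2l // eqSS => /eqP.
exact: double_inj.
Qed.

(** The graph has two vertices, [true] for even positions and [false] for odd ones. Two edges
    [Some b] lead from [true] to [false], labeled 0 and 1; the edge [None] leads back with label
    0. *)
Lemma path_set_fractal_Y : path_set_fractal Y.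
Proof.
pose src (e : option bool) := isSome e.
pose lab (e : option bool) : 'I_3 := if e is Some true then inord 1 else ord0.
exists bool, (option bool), src, (fun e => ~~ src e), lab, true.
apply/seteqP; split=> x [].
  move=> a Ya <-.
  exists (fun j => if odd j then None else Some (a j == 1%N :> nat)).
    by split=> // j; rewrite /src /=; case: (odd j).
  congr sum3; apply/funext => j; apply/val_inj => /=.
  have := Ya j./2; rewrite -[in X in _ -> X](odd_double_half j).
  rewrite !oddD odd_double addbF oddb; case: (odd j).
    by rewrite add1n => -[_ ->].
  rewrite add0n !inE => -[/orP[]/eqP-> _] //=.
  by rewrite inordK.
move=> w [w0 wS] <-; exists (lab \o w) => // k.
have wE j : src (w j) = ~~ odd j by elim: j => //= j IH; rewrite -wS IH.
split; have := wE k.*2; have := wE k.*2.+1; rewrite /= odd_double /=.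
  by move=> _; case: (w _) => //= -[] _; rewrite ?inordK.
by case: (w k.*2.+1).
Qed.

(* 306/485 and 665/1054 are convergents of the continued fraction of
   [ln 2 / ln 3]. *)
Lemma expn3_lt_expn2 : (3 ^ 306 < 2 ^ 485)%N.
Proof. lia. Qed.

Lemma expn2_lt_expn3 : (2 ^ 1054 < 3 ^ 665)%N.
Proof. lia. Qed.

(** * General bounds on Hausdorff measure and dimension *)

Lemma hausdorff_weight_ge0 {R : realType} {T : metricType R} (s : R)
  (U : set T) : (0 <= hausdorff_weight s U)%E.
Proof. by rewrite /hausdorff_weight; case: eqP => // _; exact: poweR_ge0. Qed.

Lemma hausdorff_premeasure_ge0 {R : realType} {T : metricType R}
  (s delta : R) (A : set T) : (0 <= hausdorff_premeasure s delta A)%E.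
Proof.
apply: le_ereal_inf_tmp => _ [U _ <-]; apply: nneseries_ge0 => i _ _.
exact: hausdorff_weight_ge0.
Qed.

Lemma hausdorff_measure_ge0 {R : realType} {T : metricType R}
  (s : R) (A : set T) : (0 <= hausdorff_measure s A)%E.
Proof.
apply: (le_trans (hausdorff_premeasure_ge0 s 1 A)).
by apply: ereal_sup_ubound; exists 1 => //=; exact: ltr01.
Qed.

Lemma hausdorff_premeasure_le {R : realType} {T : metricType R}
    (s delta : R) (A : set T) : 0 < delta ->
  (hausdorff_premeasure s delta A <= hausdorff_measure s A)%E.
Proof. by move=> d0; apply: ereal_sup_ubound; exists delta. Qed.

Lemma hausdorff_measure_mono {R : realType} {T : metricType R}
    (s : R) (A B : set T) : A `<=` B ->
  (hausdorff_measure s A <= hausdorff_measure s B)%E.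
Proof.
move=> AB; apply: ge_ereal_sup => _ [delta d0 <-].
apply: (le_trans _ (hausdorff_premeasure_le s delta B d0)).
apply: ereal_inf_le_tmp => _ [U [BU Ud] <-]; exists U => //; split=> //.
exact: subset_trans AB BU.
Qed.

Lemma hausdorff_dim_mono {R : realType} {T : metricType R} (A B : set T) :
  A `<=` B -> (hausdorff_dim A <= hausdorff_dim B)%E.
Proof.
move=> AB; apply: ereal_inf_le_tmp => _ [s [s0 sB] <-]; exists s => //.
split=> //; apply/eqP; rewrite eq_le hausdorff_measure_ge0 andbT -sB.
exact: hausdorff_measure_mono.
Qed.

Lemma diam_ge0 {R : realType} {T : metricType R} (U : set T) : (0 <= diam U)%E.
Proof. by apply: ereal_sup_ubound; left. Qed.

Lemma mdist_le_diam {R : realType} {T : metricType R} (U : set T) (x y : T) :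
  U x -> U y -> ((mdist x y)%:E <= diam U)%E.
Proof.
by move=> Ux Uy; apply: ereal_sup_ubound; right; exists x => //; exists y.
Qed.

Lemma diam_le {R : realType} {T : metricType R} (U : set T) (e : R) : 0 <= e ->
  (forall x y, U x -> U y -> mdist x y <= e) -> (diam U <= e%:E)%E.
Proof.
move=> e0 Ue; apply: ge_ereal_sup => _ [->|[x Ux [y Uy <-]]]; rewrite lee_fin //.
exact: Ue.
Qed.

Lemma hausdorff_measure_eq0 {R : realType} {T : metricType R} (s : R)
    (A : set T) : 0 <= s ->
  (forall eta delta : R, 0 < eta -> 0 < delta ->
    exists (N : nat) (e : R) (U : nat -> set T),
      [/\ 0 <= e <= delta, A `<=` \bigcup_(i in `I_N) U i,
          forall i, (i < N)%N -> (diam (U i) <= e%:E)%E &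
          N%:R * e `^ s <= eta]) ->
  hausdorff_measure s A = 0%E.
Proof.
move=> s0 small; apply/eqP; rewrite eq_le hausdorff_measure_ge0 andbT.
apply: ge_ereal_sup => _ [delta d0 <-]; apply/lee_addgt0Pr => eta eta0.
have [N [e [U [/andP[e0 ed] AU Ue Ns]]]] := small _ _ eta0 d0.
(* The finite cover is padded with empty sets, which have weight 0 even for [s = 0]. *)
pose V i := if (i < N)%N then U i else set0.
rewrite add0e; apply: ge_ereal_inf.
exists (\sum_(0 <= i <oo) hausdorff_weight s (V i))%E.
  exists V => //; split=> [x /AU[i /= iN Ux]|i].
    by exists i => //; rewrite /V iN.
  rewrite /V; case: ifPn => [iN|_]; last by apply: diam_le => //; exact: ltW.
  by apply: (le_trans (Ue _ iN)); rewrite lee_fin.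
rewrite (nneseries_split 0 N); last by move=> *; exact: hausdorff_weight_ge0.
rewrite add0n eseries0 ?adde0; last first.
  by move=> i Ni _; rewrite /V ltnNge Ni /hausdorff_weight eqxx.
apply: (@le_trans _ _ (N%:R * e `^ s)%:E); last by rewrite lee_fin.
rewrite mulr_natl -(subn0 N) -[X in _ *+ X]subn0 -sumr_const_nat -sumEFin subn0.
rewrite big_nat [leRHS]big_nat; apply: lee_sum => i /andP[_ iN].
rewrite /V iN /hausdorff_weight; case: eqP => _.
  by rewrite lee_fin powR_ge0.
rewrite -poweR_EFin; apply: gt0_ler_poweR (Ue _ iN) => //.
  by rewrite in_itv /= diam_ge0 leey.
by rewrite in_itv /= lee_fin e0 leey.
Qed.

(** Around any point [t] of the preimage, the others lie within [diam U] to the power [d], which is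
    at most the power [s] because the diameter is at most 1. An enclosing interval is used since the
    preimage itself may fail to be measurable. *)
Lemma preimage_in_interval {R : realType} {T : metricType R} (d s : R)
    (g : R -> T) (U : set T) :
  (forall x y : R, 0 <= x < 1 -> 0 <= y < 1 ->
    `|x - y| <= mdist (g x) (g y) `^ d) ->
  0 <= s -> s < d -> (diam U <= 1)%E ->
  exists I : set R, [/\ measurable I, `[0, 1[ `&` g @^-1` U `<=` I &
    (lebesgue_measure I <= 2%:E * hausdorff_weight s U)%E].
Proof.
move=> g_expand s0 sd U1.
have [[t [t01 Ut]]|no] := pselect (exists t, `[0, 1[%classic t /\ U (g t));
    last first.
  exists set0; split=> //; first by move=> t [t01 Ut]; apply: no; exists t.
  by rewrite measure0 mule_ge0 // hausdorff_weight_ge0.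
have : diam U \is a fin_num.
  by rewrite ge0_fin_numE ?diam_ge0 // (le_lt_trans U1) // ltry.
move=> /fineK; set r := fine (diam U) => rE.
have r0 : 0 <= r by rewrite -lee_fin rE diam_ge0.
have r1 : r <= 1 by rewrite -lee_fin rE.
have wE : hausdorff_weight s U = (r `^ s)%:E.
  rewrite /hausdorff_weight; case: eqP => [U0|_]; first by rewrite U0 in Ut.
  by rewrite -rE poweR_EFin.
exists `[t - r `^ s, t + r `^ s]%classic; split=> //.
  move=> u [u01 Uu]; rewrite /= in_itv /= -ler_distlC.
  rewrite /= !in_itv /= in u01 t01.
  apply: (le_trans (g_expand _ _ t01 u01)).
  have ge0 : 0 <= mdist (g t) (g u) by exact: mdist_ge0.
  have le : mdist (g t) (g u) <= r by rewrite -lee_fin rE mdist_le_diam.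
  apply: (@le_trans _ _ (mdist (g t) (g u) `^ s)); last first.
    by apply: ge0_ler_powR => //; rewrite nnegrE.
  (* Comparing exponents requires a positive base; at 0 the power [d] vanishes because
     [d > s >= 0]. *)
  have [->|dist0] := eqVneq (mdist (g t) (g u)) 0.
    by rewrite powR0 ?powR_ge0 // gt_eqF // (le_lt_trans s0).
  by apply: ger_powR (ltW sd); rewrite lt0r dist0 ge0 (le_trans le).
rewrite lebesgue_measure_itv /= wE; case: ifP => _.
  by rewrite -EFinB -EFinM lee_fin; lra.
by rewrite -EFinM lee_fin mulr_ge0 // powR_ge0.
Qed.

(* If [g] contracts by at most the power [d], every cover of its image pulls
   back to a cover of [0, 1[ by sets of Lebesgue measure at most twice the
   weights, so the weights sum to at least 1/2. *)
Lemma hausdorff_dim_ge {R : realType} {T : metricType R} (d : R) (g : R -> T)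
    (A : set T) :
  (forall x y : R, 0 <= x < 1 -> 0 <= y < 1 ->
    `|x - y| <= mdist (g x) (g y) `^ d) ->
  g @` `[0, 1[ `<=` A -> (d%:E <= hausdorff_dim A)%E.
Proof.
move=> g_expand gA; apply: le_ereal_inf_tmp => _ [s [s0 sA] <-].
rewrite lee_fin leNgt; apply/negP => sd.
have : (2^-1%:E <= hausdorff_premeasure s 1 A)%E.
  apply: le_ereal_inf_tmp => _ [U [AU U1] <-].
  have /choice[I IP] i :=
    preimage_in_interval d s g (U i) g_expand s0 sd (U1 i).
  have : (1 <= 2%:E * \sum_(0 <= i <oo) hausdorff_weight s (U i))%E.
    rewrite -nneseriesZl; last by move=> i _; exact: hausdorff_weight_ge0.
    apply: (@le_trans _ _ (\sum_(0 <= i <oo) lebesgue_measure (I i)))%E; last first.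
      by apply: lee_nneseries => [i _ _|i _]; [exact: measure_ge0|case: (IP i)].
    have -> : 1%E = lebesgue_measure (`[0, 1[%classic : set R).
      by rewrite lebesgue_measure_itv /= lte_fin ltr01 oppr0 adde0.
    apply: measure_sigma_subadditive => [i|//|t t01]; first by case: (IP i).
    have [i _ Ui] := AU _ (gA _ (imageP g t01)).
    by exists i => //; case: (IP i) => _ + _; apply.
  by move=> h; rewrite -(@lee_pmul2l _ 2%:E) // -EFinM mulfV.
move=> /le_trans/(_ (hausdorff_premeasure_le s 1 A ltr01)).
by rewrite sA lee_fin leNgt invr_gt0 ltr0n.
Qed.

(** * Upper bound for the dimension of [Y] *)

Lemma sum3_digit_eq (a b : digits) n :
  res (sum3 a) n = res (sum3 b) n -> forall j, (j < n)%N -> a j = b j.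
Proof.
elim: n => // n IH abn j.
have abn' : res (sum3 a) n = res (sum3 b) n.
  by rewrite -!(res_trunc _ (leqnSn n)) abn.
rewrite ltnS leq_eqVlt => /predU1P[->|]; last exact: IH.
move: abn' abn; rewrite !res_sum3 !big_nat_recr //= => -> /addnI/eqP.
by rewrite eqn_pmul2r ?expn_gt0 // => /eqP/val_inj.
Qed.

Lemma Y_residues n : exists c : nat -> nat,
  forall x, Y x -> exists2 i, (i < 2 ^ n)%N & res x n.*2 = c i.
Proof.
elim: n => [|n [c cY]].
  exists (fun=> 0%N) => x _; exists 0%N => //.
  by have := res_lt x 0; rewrite ltnS leqn0 => /eqP.
exists (fun i => c i./2 + odd i * 3 ^ n.*2)%N => x Yx.
have [i i2 ix] := cY x Yx; have [a Ya ax] := Yx.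
(* The index stores the even-position digits in binary, the newest as the lowest bit; [c] reads it
   back with [odd] and [./2]. *)
exists (i.*2 + a n.*2)%N.
  rewrite expnS mul2n -(ltn_pmul2l (isT : 0 < 2)%N) in i2 *.
  by have [+ _] := Ya n; rewrite !inE => /orP[]/eqP->; lia.
have [a01 a0] := Ya n.
rewrite -ax doubleS res_sum3 !big_nat_recr //= a0 mul0n addn0.
rewrite -res_sum3 ax ix halfD oddD odd_double doubleK /=.
by move: a01; rewrite !inE => /orP[]/eqP->; rewrite ?addn0.
Qed.

Lemma mdist_Z3_le (R : realType) (x y : Z3) n : res x n = res y n ->
  @mdist R Z3 x y <= 3^-1 ^+ n.
Proof. by move=> xy; apply/abs3_le/subZ3_eq0. Qed.

Definition log3_2_half (R : realType) : R := 2^-1 * (ln 2 / ln 3).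

Lemma log3_2_half_mul (R : realType) : log3_2_half R * ln 3 = 2^-1 * ln 2.
Proof.
have ln3 : ln 3 != 0 :> R by rewrite gt_eqF // ln_gt0 // ltr1n.
by rewrite /log3_2_half; field.
Qed.

(** Exponential form turns comparisons of powers of 2 and 3 into linear ones in their logarithms. *)
Lemma powR_third (R : realType) (s : R) n :
  (3^-1 ^+ n) `^ s = expR (- (n%:R * (s * ln 3))).
Proof.
rewrite /powR gt_eqF ?exprn_gt0 ?invr_gt0 // lnXn ?invr_gt0 //.
by rewrite lnV ?posrE // -mulr_natl; congr expR; ring.
Qed.

Lemma hausdorff_dim_Y_le (R : realType) :
  (hausdorff_dim (R := R) Y <= (log3_2_half R)%:E)%E.
Proof.
have ln2 : 0 < ln 2 :> R by rewrite ln_gt0 // ltr1n.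
have ln3 : 0 < ln 3 :> R by rewrite ln_gt0 // ltr1n.
have d0 : 0 <= log3_2_half R by rewrite mulr_ge0 // divr_ge0 // ltW.
apply/lee_addgt0Pr => e e0; rewrite -EFinD; set s := _ + _.
have s0 : 0 <= s by rewrite addr_ge0 // ltW.
apply: ereal_inf_lbound; exists s => //; split=> //.
apply: hausdorff_measure_eq0 => // eta delta eta0 delta0.
(* The cover by [2 ^ n] residue classes modulo [9 ^ n] has Hausdorff sum at most [q ^+ n]. By the
   choice of [s], [q] equals [9] to the power [- e], hence is below 1. *)
pose q : R := 2 * (3^-1 ^+ 2) `^ s.
have q0 : 0 <= q by rewrite mulr_ge0 // powR_ge0.
have q1 : q < 1.
  rewrite /q powR_third -[X in X * _](@lnK R 2) ?posrE // -expRD.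
  rewrite expR_lt1 /s [_ * ln 3]mulrDl log3_2_half_mul.
  have := mulr_gt0 e0 ln3; lra.
have /cvgr0Pnorm_le/(_ eta eta0)[n1 _ qn] : q ^+ n @[n --> \oo] --> (0 : R).
  by apply: cvg_expr; rewrite ger0_norm.
have /cvgr0Pnorm_le/(_ delta delta0)[n2 _ dn] :
    (3^-1 : R) ^+ n @[n --> \oo] --> (0 : R).
  by apply: cvg_expr; rewrite ger0_norm ?invr_ge0 // invf_lt1 // ltr1n.
(* [n1] makes the Hausdorff sum at most [eta], and [n2] the diameters at most [delta]. *)
pose n := (n1 + n2)%N; have [c cY] := Y_residues n.
exists (2 ^ n)%N, (3^-1 ^+ n.*2), (fun i => [set x | res x n.*2 = c i]).
split.
- rewrite exprn_ge0 ?invr_ge0 //=.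
  apply: le_trans (dn n.*2 _); first exact: ler_norm.
  by rewrite /= /n; lia.
- by move=> x /cY[i i2 xi]; exists i.
- move=> i _; apply: diam_le; first by rewrite exprn_ge0 ?invr_ge0.
  by move=> x y /= xi yi; apply: mdist_Z3_le; rewrite xi.
- suff -> : (2 ^ n)%:R * (3^-1 ^+ n.*2) `^ s = q ^+ n.
    apply: le_trans (qn n _); first exact: ler_norm.
    by rewrite /= /n leq_addr.
  rewrite /q exprMn natrX; congr (_ * _).
  rewrite !powR_third -expRM_natl -muln2 natrM; congr expR; ring.
Qed.

(** * Lower bound for the dimension of [Y] by binary expansion *)

Definition binary_digit (R : realType) (t : R) (n : nat) : nat :=
  (Num.truncn (2 ^+ n.+1 * t) %% 2)%N.

Definition Y_of_real (R : realType) (t : R) : Z3 :=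
  sum3 (fun j => if odd j then ord0 else inord (binary_digit R t j./2)).

Lemma Y_of_realP (R : realType) (t : R) : Y (Y_of_real R t).
Proof.
eexists; last reflexivity; move=> k /=; rewrite odd_double /= doubleK.
have d2 : (binary_digit R t k < 2)%N by rewrite ltn_mod.
split=> //; rewrite inordK ?(ltn_trans d2) //.
by rewrite !inE; case: binary_digit d2 => [|[]].
Qed.

(** Halving the integer part drops its last binary digit, which lets the integer parts of
    [2 ^+ n * t] be rebuilt digit by digit. *)
Lemma truncn_double (R : realType) (u : R) : 0 <= u ->
  (Num.truncn (2 * u) %/ 2 = Num.truncn u)%N.
Proof.
move=> u0; apply/esym/truncn_def.
have /andP[] : (Num.truncn (2 * u))%:R <= 2 * u < (Num.truncn (2 * u)).+1%:R.
  by apply: truncn_itv; rewrite mulr_ge0.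
set k := Num.truncn _; rewrite {1 2}(divn_eq k 2) -addnS.
have : (k %% 2 <= 1)%N by rewrite -ltnS ltn_mod.
rewrite -(ler_nat R) !natrD !natrM -natr1.
have : 0 <= (k %% 2)%:R :> R by [].
set x := (k %/ 2)%:R; set y := (k %% 2)%:R; rewrite -natr1 -/x -/y; lra.
Qed.

(** Among the positions below [v], [uphalf v] are even, so that many binary digits agree and both
    reals lie in the same dyadic interval. *)
Lemma Y_of_real_res_eq (R : realType) (x y : R) (v : nat) :
  0 <= x < 1 -> 0 <= y < 1 -> res (Y_of_real R x) v = res (Y_of_real R y) v ->
  `|x - y| <= 2^-1 ^+ uphalf v.
Proof.
move=> /andP[x0 x1] /andP[y0 y1] /sum3_digit_eq xy.
have fE n : (n <= uphalf v)%N ->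
    Num.truncn (2 ^+ n * x) = Num.truncn (2 ^+ n * y).
  (* Both integer parts start at 0 because [x] and [y] are below 1; afterwards the quotient by 2 is
     the previous integer part and the remainder is a binary digit. *)
  elim: n => [|n IH] nv; first by rewrite !mul1r !(@truncn_def _ _ 0) ?x0 ?y0.
  have nv2 : (n.*2 < v)%N by lia.
  have := xy _ nv2; rewrite odd_double doubleK => /(congr1 val).
  rewrite /= !inordK ?(ltn_trans (ltn_pmod _ _)) // /binary_digit => xyd.
  rewrite (divn_eq (Num.truncn (_ * x)) 2) (divn_eq (Num.truncn (_ * y)) 2) xyd.
  by rewrite exprS -!mulrA !truncn_double ?mulr_ge0 ?exprn_ge0 // IH // ltnW.
set n := uphalf v; have := fE n (leqnn _) => En.
have p0 : 0 < 2 ^+ n :> R by rewrite exprn_gt0.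
have /truncn_itv : 0 <= 2 ^+ n * x by rewrite mulr_ge0 // ltW.
have /truncn_itv : 0 <= 2 ^+ n * y by rewrite mulr_ge0 // ltW.
rewrite En -natr1 => /andP[h1 h2] /andP[h3 h4].
rewrite exprVn -(ler_pM2l p0) mulfV ?gt_eqF //.
rewrite -{1}(ger0_norm (ltW p0)) -normrM mulrBr ler_norml; lra.
Qed.

Lemma Y_of_real_expand (R : realType) (x y : R) :
  0 <= x < 1 -> 0 <= y < 1 ->
  `|x - y| <= mdist (Y_of_real R x) (Y_of_real R y) `^ log3_2_half R.
Proof.
move=> x01 y01; set X := Y_of_real R x; set Z := Y_of_real R y.
(* If the images coincide, the right-hand side carries no power of 3 to compare with; agreement to
   every order squeezes [x - y] to 0 instead. *)
have [XZ|XZ] := eqVneq X Z.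
  suff -> : x = y by rewrite subrr normr0 powR_ge0.
  apply/eqP; rewrite -subr_eq0 -normr_eq0 eq_le normr_ge0 andbT.
  apply/ler_addgt0Pr => e e0; rewrite add0r.
  have /cvgr0Pnorm_le/(_ e e0)[n _ /(_ n (leqnn n))] :
      (2^-1 : R) ^+ n @[n --> \oo] --> (0 : R).
    by apply: cvg_expr; rewrite ger0_norm ?invr_ge0 // invf_lt1 // ltr1n.
  rewrite /= => /(le_trans (ler_norm _)); apply: le_trans.
  have := @Y_of_real_res_eq R x y n.*2 x01 y01.
  by rewrite -/X -/Z XZ uphalf_double; apply.
have dE : @mdist R Z3 X Z = 3^-1 ^+ val3 (X - Z).
  by rewrite /mdist /= /dist3 /abs3 subr_eq0 (negbTE XZ).
have /subZ3_eq0 XZv : res (X - Z) (val3 (X - Z)) = 0%N.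
  by apply/(abs3_le R); rewrite -dE.
apply: (le_trans (Y_of_real_res_eq R x y _ x01 y01 XZv)).
(* The distance [3^-1 ^+ v] becomes 2 to the power [- v / 2], and [uphalf v] is at least [v / 2]. *)
rewrite dE powR_third log3_2_half_mul; set v := val3 _.
rewrite -{1}[2]lnK ?posrE // -expRN -expRM_natl ler_expR.
have ln2 : 0 <= ln 2 :> R by rewrite ln_ge0 // ler1n.
rewrite mulrN lerN2 mulrA ler_wpM2r // ler_pdivrMr //.
by rewrite -natrM ler_nat; lia.
Qed.

Lemma hausdorff_dim_ge_Y (R : realType) (A : set Z3) : Y `<=` A ->
  ((log3_2_half R)%:E <= hausdorff_dim (R := R) A)%E.
Proof.
move=> YA; apply: hausdorff_dim_ge (Y_of_real_expand R) _.
by move=> _ [t _ <-]; apply: YA; exact: Y_of_realP.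
Qed.

(** * Numerical value and conclusion *)

(** The two inequalities between powers of 2 and 3 place [ln 2 / ln 3] between 306/485 and 665/1054;
    half of either bound is within one millionth of 0.315464. *)
Lemma log3_2_half_approx (R : realType) :
  `|log3_2_half R - (315 / 10 ^+ 3 + 464 / 10 ^+ 6)| < (10 ^+ 6)^-1.
Proof.
have ln2 : 0 < ln 2 :> R by rewrite ln_gt0 // ltr1n.
have ln3 : 0 < ln 3 :> R by rewrite ln_gt0 // ltr1n.
have lnlt p q a b : (a.+1 ^ p < b.+1 ^ q)%N ->
    p%:R * ln a.+1%:R < q%:R * ln b.+1%:R :> R.
  by rewrite !mulr_natl -!lnXn // ltr_ln ?posrE ?exprn_gt0 // -!natrX ltr_nat.
have := lnlt _ _ _ _ expn3_lt_expn2; have := lnlt _ _ _ _ expn2_lt_expn3.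
rewrite /log3_2_half -(ltr_pdivrMr _ _ ln3) -(ltr_pdivlMr _ _ ln3) -!mulrA.
set r := ln 2 / ln 3 => ub lb; rewrite ltr_norml; lra.
Qed.

Theorem theorem5p1 (R : realType) :
  let half_log3_2 : R := 2^-1 * (ln 2 / ln 3) in
  (`|half_log3_2 - (315 / 10 ^+ 3 + 464 / 10 ^+ 6)| < (10 ^+ 6)^-1) /\
  [/\ Y `<=` Sigma3,
      path_set_fractal Y,
      hausdorff_dim (R := R) Y = half_log3_2%:E,
      (forall k : nat, Y `<=` C1 (Nm k.*2.+1)) &
      Y `<=` \bigcap_(k in [set k : nat | (1 <= k)%N]) C1 (Nm k.*2.+1)] /\
  [/\ (hausdorff_dim (R := R)
         [set x | Sigma3 x /\ forall k : nat, Sigma3 ((Nm k.*2.+1)%:R * x)%R]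
       >= hausdorff_dim (R := R) Y)%E,
      hausdorff_dim (R := R) Y = half_log3_2%:E &
      (hausdorff_dim (R := R) E_star >= half_log3_2%:E)%E].
Proof.
have dimY : hausdorff_dim (R := R) Y = (log3_2_half R)%:E.
  by apply/eqP; rewrite eq_le hausdorff_dim_Y_le hausdorff_dim_ge_Y.
split; first exact: log3_2_half_approx.
split; split=> //.
- exact: Y_Sigma3.
- exact: path_set_fractal_Y.
- exact: Y_C1.
- by move=> x Yx k _; exact: Y_C1.
- apply: hausdorff_dim_mono => x Yx; split; first exact: Y_Sigma3.
  by move=> k; exact: Y_mulNm.
- exact/hausdorff_dim_ge_Y/Y_E_star.
Qed.
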